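(* Let $2\le n\le\infty$ and let $\omega,\omega'$ be states on $\mathcal{O}_n$. If $\omega'\sim\omega\circ\alpha_g$ for some $g\in U(n)$, then $\kappa(\omega)=\kappa(\omega')$.
   Context: For $2\le n\le\infty$, $\mathcal{O}_n$ is the Cuntz algebra with Cuntz generators $s_1,\ldots,s_n$ (a sequence $s_1,s_2,\ldots$ if $n=\infty$): the universal unital C*-algebra generated by elements with $s_i^*s_j=\delta_{ij}I$ and $\sum_{i=1}^n s_is_i^*=I$ if $n<\infty$, respectively $\sum_{i=1}^k s_is_i^*\le I$ for all $k\geq 1$ if $n=\infty$. When $n=\infty$, $\{1,\ldots,n\}$ means $\{1,2,\ldots\}$. $U(n)$ is the rank $n$ unitary group when $n<\infty$, and the group of all unitaries on $\ell^2=\{(z_j)_{j\ge1}:\sum_{j}|z_j|^2<\infty\}$ when $n=\infty$; $\alpha$ is the $U(n)$-action on $\mathcal{O}_n$ by $*$-automorphisms with $\alpha_g(s_i)=\sum_{j=1}^n g_{ji}s_j$ for $g=(g_{ij})$ (norm-convergent sum if $n=\infty$). Let $\mathcal{I}_n=\bigcup_{l\ge0}\{1,\ldots,n\}^l$ be the set of finite words, $\{1,\ldots,n\}^0=\{\emptyset\}$, $s_J=s_{j_1}\cdots s_{j_l}$ for $J=(j_1,\ldots,j_l)$, $s_\emptyset=I$. For states $\omega,\omega'$ on $\mathcal{O}_n$, write $\omega\sim\omega'$ if their GNS representations are unitarily equivalent. For a state $\omega$ with GNS representation $(\mathcal{H},\pi,\Omega)$, let $\mathcal{K}(\omega)$ be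 the closed linear span of $\{\pi(s_J)^*\Omega: J\in\mathcal{I}_n\}$ in $\mathcal{H}$, $\mathrm{c}\dim\omega:=\dim\mathcal{K}(\omega)\in\{1,2,\ldots,\infty\}$ (Hilbert space dimension), and $\kappa(\omega):=\min\{\mathrm{c}\dim\omega':\omega'\text{ a state on }\mathcal{O}_n,\ \omega'\sim\omega\}$. *)

(* Defs.v *)
From HB Require Import structures.
From mathcomp Require Import all_boot all_order all_algebra.
From mathcomp Require Import spectral.
From mathcomp Require Import complex.
From mathcomp Require Import all_classical all_reals all_analysis.

Set Implicit Arguments.
Unset Strict Implicit.
Unset Printing Implicit Defensive.

Import Order.TTheory GRing.Theory Num.Theory Num.Def.
Import numFieldNormedType.Exports.

Local Open Scope classical_set_scope.
Local Open Scope ring_scope.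

(* {0, 1, 2, ...} together with infinity, the latter being encoded by None. *)
Definition enat : Type := option nat.

Definition enat_le (x y : enat) : bool :=
  match x, y with
  | _, None => true
  | None, Some _ => false
  | Some a, Some b => (a <= b)%N
  end.

(* The least element; every nonempty set of extended naturals has one (the
   empty set is sent to infinity). *)
Definition enat_min (S : set enat) : enat :=
  xget None [set k | S k /\ forall d, S d -> enat_le k d].

(* The index set {1,...,n}, shifted to start at 0. *)
Definition idx (n : enat) : eqType :=
  match n with
  | Some m => 'I_m
  | None => nat
  end.

Section Spans.
Variables (K : numFieldType) (V : normedModType K).

Definition lin_span (S : set V) : set V :=
  [set v | exists (k : nat) (c : 'I_k -> K) (x : 'I_k -> V),
     (forall i, S (x i)) /\ v = \sum_i c i *: x i].

Definition closed_span (S : set V) : set V := closure (lin_span S).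

Definition has_sum (n : enat) : (idx n -> V) -> V -> Prop :=
  match n with
  | Some m => fun f v => v = \sum_(j < m) f j
  | None => fun f v => series f @ \oo --> v
  end.

End Spans.

(* Unital C*-algebras.  The product is a field of the mixin because the
   hierarchy has no structure joining normed modules and rings below
   numDomainType. *)
HB.mixin Record isCStar (R : realType) A of CompleteNormedModule R[i] A := {
  cone : A;
  cmul : A -> A -> A;
  star : A -> A;
  cmulA : associative cmul;
  cmul1l : left_id cone cmul;
  cmul1r : right_id cone cmul;
  cmulDl : left_distributive cmul +%R;
  cmulDr : right_distributive cmul +%R;
  cmulZl : forall (c : R[i]) x y, cmul (c *: x) y = c *: cmul x y;
  cmulZr : forall (c : R[i]) x y, cmul x (c *: y) = c *: cmul x y;
  starK : involutive star;
  starD : {morph star : x y / x + y};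
  starZ : forall (c : R[i]) x, star (c *: x) = c^* *: star x;
  starM : forall x y, star (cmul x y) = cmul (star y) (star x);
  cmul_norm : forall x y : A, `|cmul x y| <= `|x| * `|y|;
  cstar_norm : forall x : A, `|cmul (star x) x| = `|x| ^+ 2
}.

#[short(type="cstarAlgType")]
HB.structure Definition CStarAlgebra (R : realType) :=
  {A of CompleteNormedModule R[i] A & isCStar R A}.

Notation "x ** y" := (cmul x y) (at level 40, left associativity) : ring_scope.

(* Complex Hilbert spaces; the inner product is linear on the left. *)
Record hilbertType (R : realType) := Hilbert {
  hsort :> completeNormedModType R[i];
  hdot : {dot hsort for conjC};
  hdotE : forall x : hsort, `|x| ^+ 2 = hdot x x
}.

Section CStarAlgebras.
Variable R : realType.

Definition star_morphism (A B : cstarAlgType R) (f : A -> B) : Prop :=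
  [/\ linear f, f cone = cone, {morph f : x y / x ** y}
    & {morph f : x / star x}].

Definition star_subalgebra (A : cstarAlgType R) (S : set A) : Prop :=
  [/\ S cone,
      forall (c : R[i]) x y, S x -> S y -> S (c *: x + y),
      forall x y, S x -> S y -> S (x ** y)
    & forall x, S x -> S (star x)].

Definition cstar_le (A : cstarAlgType R) (x y : A) : Prop :=
  exists b : A, y - x = star b ** b.

Definition is_state (A : cstarAlgType R) (w : A -> R[i]) : Prop :=
  [/\ scalar w, forall a, 0 <= w (star a ** a) & w cone = 1].

Section Cuntz.
Variable n : enat.

Definition cuntz_relations (A : cstarAlgType R) (s : idx n -> A) : Prop :=
  (forall i j, star (s i) ** s j = if i == j then cone else 0) /\
  match n return (idx n -> A) -> Prop with
  | Some m => fun s => \sum_(i < m) s i ** star (s i) = cone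
  | None => fun s =>
      forall k : nat, cstar_le (\sum_(i < k) s i ** star (s i)) cone
  end s.

Definition is_cuntz_algebra (A : cstarAlgType R) (s : idx n -> A) : Prop :=
  [/\ cuntz_relations s,
      forall S : set A, star_subalgebra S -> closed S -> range s `<=` S ->
        S = setT
    & forall (B : cstarAlgType R) (t : idx n -> B), cuntz_relations t ->
        exists2 f : A -> B, star_morphism f & forall i, f (s i) = t i].

Definition ell2 : set (nat -> R[i]) :=
  [set z : nat -> R[i] | cvgn (series (fun j => `|z j| ^+ 2 : R[i]^o))].

Definition ell2_dot (z y : nat -> R[i]) : R[i] :=
  limn (series (fun j => z j * (y j)^* : R[i]^o)).

Definition ell2_unitary (u : (nat -> R[i]) -> (nat -> R[i])) : Prop :=
  [/\ u @` ell2 = ell2,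
      forall (c : R[i]) z y, ell2 z -> ell2 y ->
        u (fun j => c * z j + y j) = (fun j => c * u z j + u y j)
    & forall z y, ell2 z -> ell2 y -> ell2_dot (u z) (u y) = ell2_dot z y].

(* Elements of U(n) are represented by their matrix entries; for n infinite,
   g_ij is the i-th coordinate of the image of the j-th basis vector. *)
Definition in_U : (idx n -> idx n -> R[i]) -> Prop :=
  match n return (idx n -> idx n -> R[i]) -> Prop with
  | Some m => fun g => (\matrix_(i < m, j < m) g i j) \is unitarymx
  | None => fun g => exists2 u, ell2_unitary u &
      forall i j : nat, g i j = u (fun k => (k == j)%:R) i
  end.

Variables (A : cstarAlgType R) (s : idx n -> A).

(* For g in U(n) and s generating the Cuntz algebra, there is exactly one
   *-automorphism sending s_i to sum_j g_ji s_j. *)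
Definition alpha (g : idx n -> idx n -> R[i]) : A -> A :=
  xget (id : A -> A) [set a : A -> A | [/\ star_morphism a, bijective a &
    forall i, has_sum (fun j => g j i *: s j) (a (s i))]].

Definition s_word (J : seq (idx n)) : A := foldr (fun j x => s j ** x) cone J.

End Cuntz.
End CStarAlgebras.

Section GNS.
Variables (R : realType) (A : cstarAlgType R).

Definition is_representation (H : hilbertType R) (pi : A -> H -> H) : Prop :=
  [/\ forall a, linear (pi a) /\ continuous (pi a),
      forall (c : R[i]) a b x, pi (c *: a + b) x = c *: pi a x + pi b x,
      forall a b x, pi (a ** b) x = pi a (pi b x),
      forall x, pi cone x = x
    & forall a x y, hdot H (pi a x) y = hdot H x (pi (star a) y)].

Record gns (w : A -> R[i]) := GNS {
  gns_space : hilbertType R;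
  gns_rep : A -> gns_space -> gns_space;
  gns_vec : gns_space;
  gns_repP : is_representation gns_rep;
  gns_cyclic : closure (range (fun a => gns_rep a gns_vec)) = setT;
  gns_vecP : forall a, w a = hdot gns_space (gns_rep a gns_vec) gns_vec
}.

Definition unitarily_equivalent (H H' : hilbertType R)
    (pi : A -> H -> H) (pi' : A -> H' -> H') : Prop :=
  exists U : H -> H',
    [/\ linear U, bijective U,
        forall x y, hdot H' (U x) (U y) = hdot H x y
      & forall a x, U (pi a x) = pi' a (U x)].

(* GNS representations are unique up to unitary equivalence, so that the choice
   of G and G' is irrelevant. *)
Definition state_equiv (w w' : A -> R[i]) : Prop :=
  exists (G : gns w) (G' : gns w'),
    unitarily_equivalent (@gns_rep _ G) (@gns_rep _ G').

(* The number of elements of an orthonormal basis of the closed subspace K; all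
   infinite dimensions are identified. *)
Definition hdim (H : hilbertType R) (K : set H) : enat :=
  xget None [set d' : enat | exists d (e : 'I_d -> H),
    [/\ d' = Some d,
        forall i j, hdot H (e i) (e j) = (i == j)%:R
      & closed_span (range e) = K]].

Variables (n : enat) (s : idx n -> A).

(* The adjoint of pi(s_J) is the image under pi of the adjoint of s_J. *)
Definition calK (w : A -> R[i]) (G : gns w) : set (gns_space G) :=
  closed_span (range (fun J => gns_rep (star (s_word s J)) (gns_vec G))).

Arguments calK {w} G.

(* The value does not depend on the chosen G. *)
Definition cdim (w : A -> R[i]) : enat :=
  xget None [set d | exists G : gns w, d = hdim (calK G)].

Definition kappa (w : A -> R[i]) : enat :=
  enat_min [set cdim w' | w' in [set w' | is_state w' /\ state_equiv w' w]].

End GNS.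

(* Main.v *)
Require Import Defs.
From mathcomp Require Import all_boot all_order all_algebra.
From mathcomp Require Import complex.
From mathcomp Require Import all_classical all_reals all_analysis.

Set Implicit Arguments.
Unset Strict Implicit.
Unset Printing Implicit Defensive.

Import Order.TTheory GRing.Theory Num.Theory Num.Def.
Import numFieldNormedType.Exports.

(** The number [kappa] is a minimum over the states equivalent to a given one,
    so by transitivity of the equivalence, that is, by uniqueness of the GNS
    representation ([gns_unique]), it is constant on equivalence classes. It
    remains to compare w with w o alpha_g.

    The value [alpha s g] is always a bijective *-morphism: an automorphism with
    the prescribed values on the generators if there is one, and the identity
    otherwise, where there is nothing to compare. Composition with a bijective
    *-morphism a carries the class of w onto that of w o a: a GNS triple of w,
    twisted by a, is one of w o a on the same space and with the same cyclic
    vector ([gns_comp]). The point is that the twist preserves the subspace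
    [calK], hence its dimension. In the twisted triple this subspace is the
    closed span of the vectors pi (t_J)^* om for the family
    t_i = a (s_i) = sum_j g_ji s_j, instead of the pi (s_J)^* om.

    Since g is unitary, each family lies in the closed linear span of the other
    ([in_U_family_span]); for infinite n this uses that g comes from a
    surjective isometry of l^2, and that sum_j c_j s_j has norm |c|_2. So it
    suffices that the closed span of the vectors pi (s_J)^* om depends only on
    the closed span E of the s_i. It does because it is invariant under pi (x)^*
    for every x in E ([coinvariant_rep_star]), and an adjoint of a word in the t_i is a product
    of such operators ([coinvariant_sub]).

    Passing to limits in E requires pi (x)^* to depend continuously on x in E.
    Elements of E satisfy x^* x = |x|^2 ([closed_span_star_mul]), since the
    generators do and are pairwise orthogonal; and this relation bounds the norm
    of pi (x)^* by |x| ([norm_rep_star]). *)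

(** * Closed linear spans *)

Section Subspaces.
Local Open Scope classical_set_scope.
Local Open Scope ring_scope.

Variables (K : numFieldType).

Definition is_subspace (V : lmodType K) (W : set V) : Prop :=
  W 0 /\ forall (c : K) x y, W x -> W y -> W (c *: x + y).

Lemma subspace_sum (V : lmodType K) (W : set V) (I : Type) (r : seq I)
    (c : I -> K) (x : I -> V) :
  is_subspace W -> (forall i, W (x i)) -> W (\sum_(i <- r) c i *: x i).
Proof.
move=> [W0 WD] Wx; elim: r => [|i r IH]; first by rewrite big_nil.
by rewrite big_cons; apply: WD.
Qed.

Lemma subspaceB (V : lmodType K) (W : set V) x y :
  is_subspace W -> W x -> W y -> W (x - y).
Proof. by move=> [_ WD] Wx Wy; rewrite addrC -scaleN1r; apply: WD. Qed.

Lemma linear_fun0 (V V' : lmodType K) (f : V -> V') : linear f -> f 0 = 0.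
Proof. by move=> lf; have := lf (-1) 0 0; rewrite scaler0 addr0 scaleN1r addNr. Qed.

Lemma linear_funB (V V' : lmodType K) (f : V -> V') x y :
  linear f -> f (x - y) = f x - f y.
Proof. by move=> lf; rewrite addrC -scaleN1r lf scaleN1r addrC. Qed.

Lemma preimage_subspace (V V' : lmodType K) (f : V -> V') (W : set V') :
  linear f -> is_subspace W -> is_subspace (f @^-1` W).
Proof.
move=> lf [W0 WD]; split=> [|c x y Wx Wy] /=; first by rewrite (linear_fun0 lf).
by rewrite lf; exact: WD.
Qed.

Lemma closure_sub (T : topologicalType) (B C : set T) :
  closed C -> B `<=` C -> closure B `<=` C.
Proof. by move=> Ccl BC; rewrite closureE; apply: smallest_sub. Qed.

Lemma closed_preimage (T T' : topologicalType) (f : T -> T') (C : set T') :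
  continuous f -> closed C -> closed (f @^-1` C).
Proof. by move=> cf Ccl; apply: preimage_closed => // x _; exact: cf. Qed.

Lemma closure_subspace (V : normedModType K) (W : set V) :
  is_subspace W -> is_subspace (closure W).
Proof.
move=> [W0 WD]; split; first exact: subset_closure.
have cW := @closed_closure _ W.
move=> c x y Wx Wy.
(* One summand at a time: first y runs through the closure, then x. *)
have step z : W z -> closure W (c *: z + y).
  move=> Wz; suff : closure W `<=` (fun t => c *: z + t) @^-1` closure W by exact.
  apply: closure_sub => [|t Wt]; last exact/subset_closure/WD.
  by apply: closed_preimage => // t; apply: cvgD; [exact: cvg_cst|exact: cvg_id].
suff : closure W `<=` (fun t => c *: t + y) @^-1` closure W by exact.
apply: closure_sub => //.
apply: closed_preimage => // t; apply: cvgD; last exact: cvg_cst.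
by apply: cvgZl_tmp; exact: cvg_id.
Qed.

Lemma lin_span_subspace (V : normedModType K) (S : set V) :
  is_subspace (lin_span S).
Proof.
split; first by exists 0, (fun=> 0), (fun=> 0); split; [case|rewrite big_ord0].
move=> c _ _ [k [a [x [Sx ->]]]] [l [b [y [Sy ->]]]].
exists (k + l)%N.
exists (fun i : 'I_(k + l) =>
  match fintype.split i with inl i => c * a i | inr j => b j end).
exists (fun i : 'I_(k + l) =>
  match fintype.split i with inl i => x i | inr j => y j end).
split=> [i|]; first by case: (fintype.split i).
rewrite big_split_ord scaler_sumr; congr +%R; apply: eq_bigr => i _.
  by rewrite (unsplitK (inl i)) scalerA.
by rewrite (unsplitK (inr i)).
Qed.

Lemma sub_lin_span (V : normedModType K) (S : set V) : S `<=` lin_span S.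
Proof.
by move=> x Sx; exists 1, (fun=> 1), (fun=> x); split=> //; rewrite big_ord1 scale1r.
Qed.

Lemma lin_span_sub (V : normedModType K) (S W : set V) :
  is_subspace W -> S `<=` W -> lin_span S `<=` W.
Proof.
by move=> sW SW _ [k [c [x [Sx ->]]]]; apply: subspace_sum => // i; exact: SW.
Qed.

Lemma lin_span_sum (V : normedModType K) (I : Type) (r : seq I) (c : I -> K)
    (x : I -> V) : lin_span (range x) (\sum_(i <- r) c i *: x i).
Proof.
apply: subspace_sum; first exact: lin_span_subspace.
by move=> i; apply: sub_lin_span; exists i.
Qed.

Lemma closed_span_subspace (V : normedModType K) (S : set V) :
  is_subspace (closed_span S).
Proof. exact/closure_subspace/lin_span_subspace. Qed.

Lemma sub_closed_span (V : normedModType K) (S : set V) : S `<=` closed_span S.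
Proof. by move=> x /sub_lin_span; exact: subset_closure. Qed.

Lemma closed_span_sub (V : normedModType K) (S W : set V) :
  is_subspace W -> closed W -> S `<=` W -> closed_span S `<=` W.
Proof. by move=> sW cW SW; apply: closure_sub => //; exact: lin_span_sub. Qed.

Lemma closed_span_range_ext (T : Type) (V : normedModType K) (f g : T -> V) :
  f =1 g -> closed_span (range f) = closed_span (range g).
Proof. by move=> /funext ->. Qed.

Lemma closure_near (V : normedModType K) (W : set V) x :
  closure W x <-> forall e : K, 0 < e -> exists2 y, W y & `|x - y| < e.
Proof.
split=> [Wx e e0|H B /nbhs_normP [e /= e0 eB]].
  have [y [Wy xy]] := Wx _ (nbhsx_ballx x e e0).
  by exists y => //; rewrite -ball_normE in xy.
by have [y Wy xy] := H e e0; exists y; split=> //; exact: eB.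
Qed.

Lemma cvg_norm_dominated (T : Type) (F : set_system T) {FF : Filter F}
    (V : normedModType K) (f : T -> V) (g : T -> K) (l : V) :
  (forall x, `|l - f x| <= g x) -> g @ F --> (0 : K) -> f @ F --> l.
Proof.
move=> fg g0; apply/cvgrPdist_lt => e e0.
have /cvgrPdist_lt/(_ _ e0) := g0; apply: filterS => x.
by rewrite sub0r normrN ger0_norm ?(le_trans _ (fg x)) //; exact/le_lt_trans/fg.
Qed.

(** The bound is the one satisfied by x^* x, from the splitting
    x^* x - y^* y = x^* (x - y) + (x - y)^* y; it tends to 0 with x - y. *)
Lemma quadratic_continuous (V V' : normedModType K) (q : V -> V') :
  (forall x y, `|q x - q y| <= `|x| * `|x - y| + `|x - y| * `|y|) ->
  continuous q.
Proof.
move=> qB x.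
have cB : `|x - y| @[y --> x] --> (0 : K).
  rewrite -(normr0 V) -(subrr x); apply: cvg_norm.
  by apply: cvgB; [exact: cvg_cst|exact: cvg_id].
have cN : `|y| @[y --> x] --> `|x| by apply: cvg_norm; exact: cvg_id.
have bound0 : `|x| * `|x - y| + `|x - y| * `|y| @[y --> x] --> (0 : K).
  have := cvgD (cvgM (cvg_cst `|x|) cB) (cvgM cB cN).
  by rewrite mulr0 mul0r addr0; apply.
exact: (cvg_norm_dominated (qB x) bound0).
Qed.

Lemma closed_equalizer (T : topologicalType) (V : normedModType K) (f g : T -> V) :
  continuous f -> continuous g -> closed [set x | f x = g x].
Proof.
move=> cf cg; have -> : [set x | f x = g x] = (fun x => f x - g x) @^-1` [set 0].
  by apply/seteqP; split=> x /=; [move=> ->; rewrite subrr|move/subr0_eq].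
apply: closed_preimage; first by move=> x; apply: cvgB; [exact: cf|exact: cg].
exact/accessible_closed_set1/hausdorff_accessible/norm_hausdorff.
Qed.

Lemma cvg_norm_sqr (T : Type) (F : set_system T) {FF : Filter F}
    (V : normedModType K) (f : T -> V) (l : V) :
  f @ F --> l -> (fun x => `|f x| ^+ 2 : K^o) @ F --> (`|l| ^+ 2 : K^o).
Proof.
move=> fl; have cN : `|f x| @[x --> F] --> `|l| by exact: cvg_norm.
exact: (cvgM cN cN).
Qed.

Lemma continuous_norm_sqr_scale (V V' : normedModType K) (u : V') :
  continuous (fun x : V => `|x| ^+ 2 *: u).
Proof. by move=> x; apply: cvgZr_tmp; apply: cvg_norm_sqr; exact: cvg_id. Qed.

End Subspaces.

(** * Families of isometries with orthogonal ranges *)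

Section CStarBasics.
Local Open Scope classical_set_scope.
Local Open Scope complex_scope.
Local Open Scope ring_scope.

Variables (R : realType) (A : cstarAlgType R).
Implicit Types x y : A.

Lemma cmul0l x : 0 ** x = 0 :> A.
Proof. by rewrite -(scale0r (0 : A)) cmulZl !scale0r. Qed.

Lemma cmul0r x : x ** 0 = 0.
Proof. by rewrite -(scale0r (0 : A)) cmulZr !scale0r. Qed.

Lemma star0 : star (0 : A) = 0.
Proof. by rewrite -(scale0r (0 : A)) starZ rmorph0 !scale0r. Qed.

Lemma starB x y : star (x - y) = star x - star y.
Proof. by rewrite -scaleN1r starD starZ rmorphN1 scaleN1r. Qed.

Lemma star1 : star (cone : A) = cone.
Proof. by rewrite -[LHS]cmul1r -[X in _ ** X]starK -starM cmul1r starK. Qed.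

Lemma cmulBl x y z : (x - y) ** z = x ** z - y ** z.
Proof. by rewrite cmulDl -(scaleN1r y) cmulZl scaleN1r. Qed.

Lemma cmulBr x y z : z ** (x - y) = z ** x - z ** y.
Proof. by rewrite cmulDr -(scaleN1r y) cmulZr scaleN1r. Qed.

(** The C*-identity gives |x|^2 = |x^* x| <= |x^*| |x|, hence |x| <= |x^*|;
    the reverse inequality is the same one for x^*. *)
Lemma norm_star x : `|star x| = `|x|.
Proof.
have le_star y : `|y| <= `|star y|.
  have [->|y0] := eqVneq y 0; first by rewrite star0.
  rewrite -(ler_pM2r (_ : 0 < `|y|)) ?normr_gt0 // -expr2 -cstar_norm.
  exact: cmul_norm.
by apply/le_anti; rewrite le_star andbT -{2}[x]starK le_star.
Qed.

Lemma star_mul_continuous : continuous (fun x => star x ** x).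
Proof.
apply: quadratic_continuous => x y.
have -> : star x ** x - star y ** y = star x ** (x - y) + star (x - y) ** y.
  by rewrite starB cmulBl cmulBr addrA subrK.
apply: le_trans (ler_normD _ _) _; apply: lerD.
  by rewrite -(norm_star x) cmul_norm.
by rewrite -(norm_star (x - y)) cmul_norm.
Qed.

Definition orthoisometric (I : eqType) (s : I -> A) : Prop :=
  forall i j, star (s i) ** s j = if i == j then cone else 0.

(** A state detects the scalar: w (x^* x) = c forces c >= 0, and then the
    C*-identity identifies c with the squared norm (the unit has norm 1 because
    w cone = 1 excludes the zero algebra). *)
Lemma state_star_mul_cone (w : A -> R[i]) x (c : R[i]) :
  is_state w -> star x ** x = c *: cone -> c = `|x| ^+ 2.
Proof.
move=> [wlin wpos w1] xc.
have w0 : w 0 = 0 by have := wlin (-1) 0 0; rewrite scaler0 addr0 mulN1r addNr.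
have c0 : 0 <= c.
  by have := wpos x; rewrite xc -[c *: cone]addr0 wlin w1 w0 addr0 mulr1.
have cone0 : `|cone : A| != 0.
  apply/eqP => /normr0_eq0 c10; move: w1; rewrite c10 w0 => /esym/eqP.
  by rewrite oner_eq0.
have n1 : `|cone : A| = 1.
  by apply: (mulfI cone0); rewrite mulr1 -expr2 -cstar_norm star1 cmul1r.
by rewrite -cstar_norm xc normrZ n1 mulr1 ger0_norm.
Qed.

(** By sesquilinearity it is enough to look at products of generators,
    which are 0 or the unit. *)
Lemma lin_span_star_mul (I : eqType) (s : I -> A) x y : orthoisometric s ->
  lin_span (range s) x -> lin_span (range s) y ->
  exists c : R[i], star x ** y = c *: cone.
Proof.
move=> os xs ys.
pose C : set A := [set z | exists c : R[i], z = c *: cone].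
have sC : is_subspace C.
  split; first by exists 0; rewrite scale0r.
  move=> c _ _ [a ->] [b ->]; exists (c * a + b).
  by rewrite scalerDl scalerA.
suff sub : lin_span (range s) `<=` (fun t => C (star x ** t)) by exact: (sub _ ys).
apply: lin_span_sub => [|_ [j _ <-]].
    split=> [|c u v Cu Cv]; first by rewrite cmul0r; exact: sC.1.
    by rewrite cmulDr cmulZr; exact: sC.2.
  move: x xs; apply: lin_span_sub => [|_ [i _ <-]].
    split=> [|c u v Cu Cv]; first by rewrite star0 cmul0l; exact: sC.1.
    by rewrite starD starZ cmulDl cmulZl; exact: sC.2.
  rewrite os; case: eqP => _; [exists 1|exists 0]; by rewrite ?scale1r ?scale0r.
Qed.

(** The closed span of the generators is a Hilbert space inside the algebra:
    every element is a multiple of an isometry. The relation is a closed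
    condition, so it passes from the span to its closure. *)
Lemma closed_span_star_mul (w : A -> R[i]) (I : eqType) (s : I -> A) x :
  is_state w -> orthoisometric s ->
  closed_span (range s) x -> star x ** x = `|x| ^+ 2 *: cone.
Proof.
move=> sw os; move: x; apply: closure_sub => [|x xs] /=.
  apply: closed_equalizer; first exact: star_mul_continuous.
  exact: continuous_norm_sqr_scale.
have [c xc] := lin_span_star_mul os xs xs.
by rewrite -(state_star_mul_cone sw xc).
Qed.

End CStarBasics.

(** * Representations and coinvariant spaces *)

Section Representations.
Local Open Scope classical_set_scope.
Local Open Scope complex_scope.
Local Open Scope ring_scope.

Variables (R : realType) (A : cstarAlgType R) (H : hilbertType R).
Variables (pi : A -> H -> H) (rep : is_representation pi).
Implicit Types (x y : A) (xi eta : H).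

Lemma rep_linear x : linear (pi x).
Proof. by case: rep => L _ _ _ _; case: (L x). Qed.

Lemma rep_continuous x : continuous (pi x).
Proof. by case: rep => L _ _ _ _; case: (L x). Qed.

Lemma rep_linearl eta : linear (pi^~ eta).
Proof. by case: rep => _ L _ _ _ c x y; rewrite L. Qed.

Lemma repB x y eta : pi (x - y) eta = pi x eta - pi y eta.
Proof. exact: (linear_funB x y (rep_linearl eta)). Qed.

Lemma repM x y eta : pi (x ** y) eta = pi x (pi y eta).
Proof. by case: rep. Qed.

Lemma rep1 eta : pi cone eta = eta.
Proof. by case: rep. Qed.

Lemma rep_adj x xi eta : hdot H (pi x xi) eta = hdot H xi (pi (star x) eta).
Proof. by case: rep. Qed.

(** Multiples of isometries act boundedly, and so do their adjoints. With
    T = pi x, so that T^* T = l = |x|^2, the estimate is what remains of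
    0 <= |l eta - T T^* eta|^2 after expansion and division by l. *)
Lemma norm_rep_star x eta :
  star x ** x = `|x| ^+ 2 *: cone -> `|pi (star x) eta| <= `|x| * `|eta|.
Proof.
move=> xx; have [->|x0] := eqVneq x 0.
  by rewrite star0 (linear_fun0 (rep_linearl eta)) !normr0 mul0r.
set l := `|x| ^+ 2 in xx; set zeta := pi (star x) eta.
have l_gt0 : 0 < l by rewrite exprn_gt0 // normr_gt0.
have normT : hdot H (pi x zeta) (pi x zeta) = l * `|zeta| ^+ 2.
  rewrite rep_adj -repM xx -[l *: cone]addr0 rep_linearl rep1.
  rewrite (linear_fun0 (rep_linearl zeta)) addr0 linearZr_LR /=.
  by rewrite geC0_conj ?ltW // hdotE.
have dotT : hdot H (l *: eta) (pi x zeta) = l * `|zeta| ^+ 2.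
  rewrite linearZl_LR /=; congr (_ * _).
  rewrite -[x in pi x zeta]starK.
  by rewrite -rep_adj hdotE.
have lz_ge0 : 0 <= l * `|zeta| ^+ 2.
  by apply: mulr_ge0; [exact: ltW|exact: exprn_ge0].
have := dnorm_ge0 (hdot H) (l *: eta - pi x zeta).
rewrite dnormB normT dotT dnormZ -hdotE.
rewrite (geC0_conj lz_ge0)
  opprD addrA addrK (ger0_norm (ltW l_gt0)) expr2 -mulrA -mulrBr.
rewrite pmulr_rge0 // subr_ge0 -exprMn.
by rewrite ler_pXn2r // ?nnegrE ?mulr_ge0.
Qed.

Section CoinvariantSpace.
Variables (n : enat) (om : H).

Definition coinvariant (s : idx n -> A) : set H :=
  closed_span (range (fun J => pi (star (s_word s J)) om)).

(** For a generator, pi (s_i)^* maps the vectors pi (s_J)^* om to one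
    another, since s_J s_i is again the element of a word. Sums follow by
    linearity, and limits by the bound [norm_rep_star], which applies because differences of
    elements of the closed span are again multiples of isometries. *)
Lemma coinvariant_rep_star (w : A -> R[i]) (s : idx n -> A) x eta :
  is_state w -> orthoisometric s ->
  closed_span (range s) x -> coinvariant s eta -> coinvariant s (pi (star x) eta).
Proof.
move=> sw os xs etaK.
have sK : is_subspace (coinvariant s) by exact: closed_span_subspace.
have cK : closed (coinvariant s) by exact: closed_closure.
have gen i : coinvariant s `<=` pi (star (s i)) @^-1` coinvariant s.
  apply: closed_span_sub => [||_ [J _ <-]].
  - exact: (preimage_subspace (rep_linear _)).
  - by apply: closed_preimage => //; exact: rep_continuous.
  - apply: sub_closed_span; exists (rcons J i) => //.
    rewrite -repM -starM; congr (pi (star _) _).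
    rewrite /s_word; elim: J => [|j J IH] /=; first by rewrite cmul1l cmul1r.
    by rewrite IH cmulA.
have lin y : lin_span (range s) y -> coinvariant s (pi (star y) eta).
  suff sub : lin_span (range s) `<=` (fun y => coinvariant s (pi (star y) eta)).
    exact: sub.
  apply: lin_span_sub => [|_ [i _ <-]]; last exact: gen.
  split=> [|c u v Ku Kv].
    by rewrite star0 (linear_fun0 (rep_linearl eta)); exact: sK.1.
  by rewrite starD starZ rep_linearl; exact: sK.2.
rewrite ((closure_id (coinvariant s)).1 cK); apply/closure_near => e e0.
(* Adding 1 keeps the denominator positive when eta = 0. *)
have d0 : 0 < e / (`|eta| + 1) by rewrite divr_gt0 // ltr_wpDl.
have [y ys xy] := (closure_near _ _).1 xs _ d0.
exists (pi (star y) eta); first exact: lin.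
rewrite -repB -starB; apply: le_lt_trans (norm_rep_star _ _) _.
  apply: (closed_span_star_mul sw os).
  apply: (subspaceB _ xs (subset_closure ys)).
  exact: closed_span_subspace.
rewrite -(@ltr_pM2r _ (`|eta| + 1)) ?ltr_wpDl // in xy.
rewrite divfK ?gt_eqF ?ltr_wpDl // in xy.
by apply: le_lt_trans xy; rewrite ler_wpM2l // lerDl.
Qed.

(** The adjoint of a word in the t_j is a product of adjoints of elements of
    the closed span of s, each of which preserves the space of s. *)
Lemma coinvariant_sub (w : A -> R[i]) (s t : idx n -> A) :
  is_state w -> orthoisometric s -> range t `<=` closed_span (range s) ->
  coinvariant t `<=` coinvariant s.
Proof.
move=> sw os ts.
apply: closed_span_sub => [||_ [J _ <-]].
- exact: closed_span_subspace.
- exact: closed_closure.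
have : coinvariant s om.
  by apply: sub_closed_span; exists [::] => //=; rewrite star1 rep1.
rewrite -/(coinvariant s).
(* Each letter peeled off the word moves the vector, so it is generalized
   apart from the cyclic vector that defines the space. *)
elim: J {1 2}om => [|j J IH] eta etaK /=; first by rewrite star1 rep1.
rewrite starM repM; apply: IH.
by apply: coinvariant_rep_star etaK => //; [exact: sw|apply: ts; exists j].
Qed.

End CoinvariantSpace.

End Representations.

(** * Extension of densely defined isometries *)

Section IsometricExtension.
Local Open Scope classical_set_scope.
Local Open Scope ring_scope.

Variables (K : numFieldType) (D : lmodType K).

Lemma pos_common_bound (d e : K) : 0 < d -> 0 < e ->
  exists m, [/\ 0 < m, m <= d & m <= e].
Proof.
move=> d0 e0; case: (real_leP (gtr0_real d0) (gtr0_real e0)) => de.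
  by exists d.
by exists e; split=> //; exact: ltW.
Qed.

(** The relation that becomes the graph of the isometry extending
    f a |-> f' a; taking the closure of the pairs avoids choosing
    approximating sequences, and makes the two sides symmetric. *)
Definition graph_closure (V V' : normedModType K) (f : D -> V) (f' : D -> V') :
  set (V * V') := closure (range (fun a => (f a, f' a))).

Lemma graph_closure_subspace (V V' : normedModType K) (f : D -> V) (f' : D -> V') :
  linear f -> linear f' -> is_subspace (graph_closure f f').
Proof.
move=> lf lf'; apply: closure_subspace; split.
  by exists 0 => //; rewrite (linear_fun0 lf) (linear_fun0 lf').
by move=> c _ _ [a _ <-] [b _ <-]; exists (c *: a + b) => //; rewrite lf lf'.
Qed.

Lemma graph_closure_sym (V V' : normedModType K) (f : D -> V) (f' : D -> V') x y :
  graph_closure f f' (x, y) -> graph_closure f' f (y, x).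
Proof.
suff sub : graph_closure f f' `<=` (fun p => (p.2, p.1)) @^-1` graph_closure f' f.
  exact: sub.
apply: closure_sub => [|_ [a _ <-]]; last by apply: subset_closure; exists a.
apply: closed_preimage; last exact: closed_closure.
by move=> p; apply: cvg_pair; [exact: cvg_snd|exact: cvg_fst].
Qed.

Lemma graph_closure_norm (V V' : normedModType K) (f : D -> V) (f' : D -> V') x y :
  (forall a, `|f a| = `|f' a|) -> graph_closure f f' (x, y) -> `|x| = `|y|.
Proof.
move=> ff'.
suff sub : graph_closure f f' `<=` [set p | `|p.1| = `|p.2| :> K^o] by exact: sub.
apply: closure_sub => [|_ [a _ <-]] //=.
by apply: closed_equalizer => p; apply: cvg_norm; [exact: cvg_fst|exact: cvg_snd].
Qed.

(** The images under f' of the points a with f a near x form a Cauchy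
    filter, because f' varies over these points exactly as much as f does; its
    limit is the value at x. *)
Lemma graph_closure_total (V : normedModType K) (V' : completeNormedModType K)
    (f : D -> V) (f' : D -> V') :
  linear f -> linear f' -> (forall a, `|f a| = `|f' a|) ->
  closure (range f) = setT -> forall x, exists y, graph_closure f f' (x, y).
Proof.
move=> lf lf' ff' fdense x.
have near e : 0 < e -> exists a, `|x - f a| < e.
  move=> e0; have [|_ [a _ <-] xa] := (closure_near (range f) x).1 _ e e0.
    by rewrite fdense.
  by exists a; exact: xa.
pose F := filter_from [set e : K | 0 < e] (fun e => f' @` [set a | `|x - f a| < e]).
have FF : ProperFilter F.
  apply: filter_from_proper => [|e /near [a xa]]; last by exists (f' a), a.
  apply: filter_from_filter; first by exists 1 => /=.
  move=> e1 e2 /= e10 e20.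
  have [m [m0 m1 m2]] := pos_common_bound e10 e20.
  exists m => // _ [a /= xa <-].
  by split; exists a => //=; exact: lt_le_trans xa _.
have /cauchy_cvg/cvg_ex [y Fy] : cauchy F.
  apply: cauchy_exP => e e0; have e20 : 0 < e / 2 by rewrite divr_gt0.
  have [a xa] := near _ e20.
  exists (f' a), (e / 2) => // _ [b /= xb <-]; rewrite -ball_normE /=.
  rewrite -(linear_funB _ _ lf') -ff' (linear_funB _ _ lf) -[f a](subrK x) -addrA.
  apply: le_lt_trans (ler_normD _ _) _.
  by rewrite [e]splitr ltrD // distrC.
exists y => B /nbhs_ballP [e /= e0 eB].
have /Fy [d /= d0 dB] := nbhsx_ballx y e e0.
have [m [m0 m1 m2]] := pos_common_bound d0 e0.
have [a xa] := near _ m0.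
exists (f a, f' a); split; first by exists a.
apply: eB; split => /=.
  by rewrite -ball_normE /=; exact: lt_le_trans m2.
by apply: dB; exists a => //=; exact: lt_le_trans m1.
Qed.

(** Density of both ranges makes the closed relation total in both
    directions, and equality of norms makes it single-valued in both. *)
Lemma isometric_extension (V V' : completeNormedModType K)
    (f : D -> V) (f' : D -> V') :
  linear f -> linear f' -> (forall a, `|f a| = `|f' a|) ->
  closure (range f) = setT -> closure (range f') = setT ->
  exists U : V -> V', [/\ linear U, bijective U, forall x, `|U x| = `|x|
    & forall a, U (f a) = f' a].
Proof.
move=> lf lf' ff' fd fd'.
have /choice [U UG] := graph_closure_total lf lf' ff' fd.
have /choice [U' U'G] := graph_closure_total lf' lf (fun a => esym (ff' a)) fd'.
have sG := graph_closure_subspace lf lf'.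
have uniq x x' y y' : graph_closure f f' (x, y) -> graph_closure f f' (x', y') ->
    `|x - x'| = `|y - y'|.
  by move=> xy xy'; apply: (graph_closure_norm ff'); exact: (subspaceB sG xy xy').
have funct x y : graph_closure f f' (x, y) -> U x = y.
  move=> xy; apply/eqP; rewrite -subr_eq0 -normr_eq0.
  by rewrite -(uniq _ _ _ _ (UG x) xy) subrr normr0.
exists U; split.
- by move=> c x y; apply: funct; exact: (sG.2 c _ _ (UG x) (UG y)).
- exists U' => x.
    have := uniq _ _ _ _ (graph_closure_sym (U'G (U x))) (UG x).
    by rewrite subrr normr0 => /normr0_eq0/subr0_eq.
  by apply: funct; exact: graph_closure_sym.
- by move=> x; rewrite (graph_closure_norm ff' (UG x)).
- by move=> a; apply: funct; apply: subset_closure; exists a.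
Qed.

End IsometricExtension.

(** * Uniqueness of the GNS representation *)

Section Equivalence.
Local Open Scope classical_set_scope.
Local Open Scope complex_scope.
Local Open Scope ring_scope.

Variables (R : realType).

(** Polarization: given the norms of x and y, that of x + y determines the
    real part of the inner product, and that of i x + y its imaginary part. *)
Lemma norm_preserving_hdot (H H' : hilbertType R) (U : H -> H') :
  linear U -> (forall x, `|U x| = `|x|) ->
  forall x y, hdot H' (U x) (U y) = hdot H x y.
Proof.
move=> lU nU x y.
(* Twice the real part of the inner product is determined by the norm. *)
have re (u v : H) : hdot H' (U u) (U v) + (hdot H' (U u) (U v))^*
    = hdot H u v + (hdot H u v)^*.
  have UD : U (u + v) = U u + U v by rewrite -[u]scale1r lU !scale1r.
  have := nU (u + v); move/(congr1 (fun r => r ^+ 2)).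
  by rewrite !hdotE UD !dnormD -!hdotE !nU => /addrI.
have := re x y; have := re ('i *: x) y.
have -> : U ('i *: x) = 'i *: U x.
  by rewrite -[X in U X]addr0 lU (linear_fun0 lU) addr0.
rewrite !linearZl_LR /= !rmorphM /= conjCi !mulNr -!mulrBr.
move/(mulfI (neq0Ci _)) => im re_xy.
apply: (@mulIf _ 2); rewrite ?pnatr_eq0 // !mulr_natr !mulr2n.
set d := hdot H' _ _ in im re_xy *; set d' := hdot H _ _ in im re_xy *.
have -> : d + d = (d + d^*) + (d - d^*) by rewrite addrACA subrr addr0.
by rewrite im re_xy addrACA subrr addr0.
Qed.

Lemma isometry_continuous (V V' : normedModType R[i]) (U : V -> V') :
  linear U -> (forall x, `|U x| = `|x|) -> continuous U.
Proof.
move=> lU nU x; apply/cvgrPdist_lt => e e0.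
apply: filterS (nbhsx_ballx x e e0) => y; rewrite -ball_normE /=.
by rewrite -(linear_funB _ _ lU) nU.
Qed.

Variable A : cstarAlgType R.

Lemma unitarily_equivalent_sym (H H' : hilbertType R)
    (pi : A -> H -> H) (pi' : A -> H' -> H') :
  unitarily_equivalent pi pi' -> unitarily_equivalent pi' pi.
Proof.
move=> [U [lU [V UV VU] dU pU]]; exists V; split.
- by move=> c x y; apply: (can_inj UV); rewrite lU !VU.
- by exists U.
- by move=> x y; rewrite -dU !VU.
- by move=> a x; apply: (can_inj UV); rewrite pU !VU.
Qed.

Lemma unitarily_equivalent_trans (H1 H2 H3 : hilbertType R)
    (pi1 : A -> H1 -> H1) (pi2 : A -> H2 -> H2) (pi3 : A -> H3 -> H3) :
  unitarily_equivalent pi1 pi2 -> unitarily_equivalent pi2 pi3 ->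
  unitarily_equivalent pi1 pi3.
Proof.
move=> [U [lU bU dU pU]] [V [lV bV dV pV]]; exists (V \o U); split.
- by move=> c x y /=; rewrite lU lV.
- exact: bij_comp.
- by move=> x y /=; rewrite dV.
- by move=> a x /=; rewrite pU pV.
Qed.

(** The map pi a om |-> pi' a om' is isometric because both squared norms are
    w (a^* a), and cyclicity makes both ranges dense. The extension
    intertwines the representations on a dense set, hence everywhere. *)
Lemma gns_unique (w : A -> R[i]) (G G' : gns w) :
  unitarily_equivalent (@gns_rep _ _ _ G) (@gns_rep _ _ _ G').
Proof.
have rG := gns_repP G; have rG' := gns_repP G'.
have normE (L : gns w) a : `|gns_rep a (gns_vec L)| ^+ 2 = w (star a ** a).
  have rL := gns_repP L.
  by rewrite hdotE (gns_vecP L) (repM rL) (rep_adj rL (star a)) starK.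
have eqn a : `|gns_rep a (gns_vec G)| = `|gns_rep a (gns_vec G')|.
  by apply/eqP; rewrite -(@eqrXn2 _ 2) // !normE.
have [U [lU bU nU Uf]] := isometric_extension (rep_linearl rG _)
  (rep_linearl rG' _) eqn (gns_cyclic G) (gns_cyclic G').
exists U; split=> //; first exact: norm_preserving_hdot.
move=> b x; have cU := isometry_continuous lU nU.
suff : closure (range (fun a => gns_rep a (gns_vec G))) `<=`
    [set x | U (gns_rep b x) = gns_rep b (U x)].
  by rewrite gns_cyclic; apply.
apply: closure_sub => [|_ [a _ <-]] /=; last by rewrite -(repM rG) !Uf (repM rG').
apply: closed_equalizer => y.
  by apply: continuous_comp; [exact: (rep_continuous rG)|exact: cU].
by apply: continuous_comp; [exact: cU|exact: (rep_continuous rG')].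
Qed.

Lemma state_equiv_sym (w w' : A -> R[i]) : state_equiv w w' -> state_equiv w' w.
Proof.
by move=> [G [G' GG']]; exists G', G; exact: unitarily_equivalent_sym.
Qed.

(** Two equivalences may use different GNS triples of the middle state,
    which is where uniqueness is needed. *)
Lemma state_equiv_trans (w1 w2 w3 : A -> R[i]) :
  state_equiv w1 w2 -> state_equiv w2 w3 -> state_equiv w1 w3.
Proof.
move=> [G1 [G2 e12]] [G2' [G3 e23]]; exists G1, G3.
apply: unitarily_equivalent_trans e12 _.
exact: unitarily_equivalent_trans (gns_unique G2 G2') e23.
Qed.

(** By transitivity the minima are taken over the same class of states. *)
Lemma kappa_state_equiv (n : enat) (s : idx n -> A) (w w' : A -> R[i]) :
  state_equiv w w' -> kappa s w = kappa s w'.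
Proof.
move=> ww'; rewrite /kappa; congr (enat_min [set cdim s v | v in _]).
apply/seteqP; split=> v [sv ev]; split=> //.
  exact: state_equiv_trans ww'.
exact: state_equiv_trans (state_equiv_sym ww').
Qed.

End Equivalence.

(** * Transport along automorphisms *)

Section Automorphisms.
Local Open Scope classical_set_scope.
Local Open Scope complex_scope.
Local Open Scope ring_scope.

Variables (R : realType) (A : cstarAlgType R).
Implicit Types (a b : A -> A) (w v : A -> R[i]).

Lemma star_morphism_inverse a : star_morphism a -> bijective a ->
  exists b, [/\ star_morphism b, cancel a b & cancel b a].
Proof.
move=> [la a1 aM aS] [b ab ba]; exists b; split=> //; split.
- by move=> c x y; apply: (can_inj ab); rewrite la !ba.
- by rewrite -a1 ab.
- by move=> x y; apply: (can_inj ab); rewrite aM !ba.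
- by move=> x; apply: (can_inj ab); rewrite aS !ba.
Qed.

Lemma is_state_comp a w : star_morphism a -> is_state w -> is_state (w \o a).
Proof.
move=> [la a1 aM aS] [lw pw w1]; split=> /=; last by rewrite a1.
  by move=> c x y /=; rewrite la lw.
by move=> x; rewrite aM aS.
Qed.

Lemma is_representation_comp a (H : hilbertType R) (pi : A -> H -> H) :
  star_morphism a -> is_representation pi -> is_representation (fun x => pi (a x)).
Proof.
move=> [la a1 aM aS] [L l M p1 adj]; split=> //.
- by move=> c x y xi; rewrite la l.
- by move=> x y xi; rewrite aM M.
- by move=> xi; rewrite a1.
- by move=> x xi eta; rewrite adj aS.
Qed.

Lemma cyclic_comp a b (H : hilbertType R) (pi : A -> H -> H) (om : H) :
  cancel b a -> closure (range (fun x => pi x om)) = setT ->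
  closure (range (fun x => pi (a x) om)) = setT.
Proof.
move=> ba <-; congr closure; apply/seteqP; split=> _ [x _ <-].
  by exists (a x).
by exists (b x) => //; rewrite ba.
Qed.

Lemma vec_comp a v w (G : gns w) : (forall x, v x = w (a x)) -> forall x,
  v x = hdot (gns_space G) (gns_rep (a x) (gns_vec G)) (gns_vec G).
Proof. by move=> vw x; rewrite vw (gns_vecP G). Qed.

(** Twisting a GNS triple of w by an automorphism a gives one of w o a on the
    same space. The state v is kept abstract up to pointwise equality so that
    twisting back by the inverse b yields a triple of w itself, without a
    transport along (w o a) o b = w. *)
Definition gns_comp a b (ma : star_morphism a) (ba : cancel b a) v w
    (vw : forall x, v x = w (a x)) (G : gns w) : gns v :=
  GNS (is_representation_comp ma (gns_repP G)) (cyclic_comp ba (gns_cyclic G))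
    (vec_comp G vw).

Lemma state_equiv_comp a b v w : star_morphism a -> cancel b a ->
  state_equiv v w -> state_equiv (v \o a) (w \o a).
Proof.
move=> ma ba [G [G' [U [lU bU dU pU]]]].
exists (gns_comp ma ba (fun=> erefl) G), (gns_comp ma ba (fun=> erefl) G').
by exists U; split=> // x xi; exact: pU.
Qed.

Section Invariance.
Variables (n : enat) (s : idx n -> A) (a b : A -> A).
Hypotheses (ma : star_morphism a) (mb : star_morphism b).
Hypotheses (ab : cancel a b) (ba : cancel b a).
Hypothesis os : orthoisometric s.
Hypothesis as_in_s : range (a \o s) `<=` closed_span (range s).
Hypothesis s_in_as : range s `<=` closed_span (range (a \o s)).

Lemma star_morphism_word J : a (s_word s J) = s_word (a \o s) J.
Proof.
by case: ma => _ a1 aM _; elim: J => [|j J IH] //=; rewrite aM -IH.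
Qed.

Lemma orthoisometric_comp : orthoisometric (a \o s).
Proof.
case: ma => la a1 aM aS i j /=; rewrite -aS -aM os.
by case: eqP => // _; rewrite (linear_fun0 la).
Qed.

(** In the twisted triple the coinvariant space of s is that of the family
    a o s in the original one, and the two families have the same closed span. *)
Lemma calK_comp v w (vw : forall x, v x = w (a x)) (G : gns w) : is_state w ->
  @calK _ _ _ s _ (gns_comp ma ba vw G) = @calK _ _ _ s _ G.
Proof.
move=> sw; have rG := gns_repP G.
have -> : @calK _ _ _ s _ (gns_comp ma ba vw G) =
    coinvariant (@gns_rep _ _ _ G) (gns_vec G) (a \o s).
  apply: closed_span_range_ext => J /=.
  by have [_ _ _ aS] := ma; rewrite aS star_morphism_word.
apply/seteqP; split.
  exact: (coinvariant_sub rG sw os as_in_s).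
exact: (coinvariant_sub rG sw orthoisometric_comp s_in_as).
Qed.

(** The two sets of dimensions agree: a triple of w o a, twisted by the
    inverse b, is a triple of w with the same coinvariant space. *)
Lemma cdim_comp w : is_state w -> cdim s (w \o a) = cdim s w.
Proof.
move=> sw; rewrite /cdim; congr xget; apply/seteqP; split=> _ [G ->].
  have wab x : w x = (w \o a) (b x) by rewrite /= ba.
  pose L := gns_comp mb ab wab G; exists L.
  rewrite -(calK_comp (fun=> erefl) L sw).
  congr hdim; apply: closed_span_range_ext => J /=.
  by rewrite ab.
by exists (gns_comp ma ba (fun=> erefl) G); rewrite calK_comp.
Qed.

(** Composition with a is a bijection, with inverse composition with b, from
    the class of w onto that of w o a, and it preserves the dimension. *)
Lemma kappa_comp w : kappa s (w \o a) = kappa s w.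
Proof.
have wab (v : A -> R[i]) : (v \o b) \o a = v by apply/funext => x /=; rewrite ab.
have wba (v : A -> R[i]) : (v \o a) \o b = v by apply/funext => x /=; rewrite ba.
rewrite /kappa; congr enat_min; apply/seteqP; split=> _ [v [sv ev] <-].
  exists (v \o b).
    split; first exact: is_state_comp.
    by rewrite -(wba w); exact: (state_equiv_comp mb ab).
  by rewrite -{2}(wab v) cdim_comp //; exact: is_state_comp.
exists (v \o a); last exact: cdim_comp.
by split; [exact: is_state_comp|exact: (state_equiv_comp ma ba)].
Qed.

End Invariance.
End Automorphisms.

(** * Truncations in l^2 *)

Section SeriesTails.
Local Open Scope classical_set_scope.
Local Open Scope ring_scope.
Variables (K : numFieldType) (V : normedModType K).

Lemma closure_cvg (T : Type) (F : set_system T) {FF : ProperFilter F}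
    (f : T -> V) (l : V) (W : set V) :
  (forall x, W (f x)) -> f @ F --> l -> closure W l.
Proof.
move=> Wf fl; apply/closure_near => e e0.
have /cvgrPdist_lt/(_ e e0)/filter_ex[x xe] := fl.
by exists (f x).
Qed.

Lemma series_tail_cvg (f : nat -> V) (l : V) (N : nat) :
  series f @ \oo --> l ->
  series (fun j => if (j < N)%N then 0 else f j) @ \oo --> l - series f N.
Proof.
move=> fl.
have : (fun M => series f M - series f N) @ \oo --> l - series f N.
  by apply: cvgB => //; exact: cvg_cst.
apply: cvg_trans; apply: near_eq_cvg; exists N => // M /= NM; rewrite !seriesEnat /=.
rewrite [in LHS](big_cat_nat (leq0n N) NM) /=.
rewrite [in RHS](big_cat_nat (leq0n N) NM) /= addrC addrK.
have -> : \sum_(0 <= j < N) (if (j < N)%N then 0 else f j) = 0.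
  by rewrite big_nat big1 // => j /andP[_ ->].
by rewrite add0r !big_nat; apply: eq_bigr => j /andP[Nj _]; rewrite ltnNge Nj.
Qed.

Lemma series_finsupp_cvg (f : nat -> V) (N : nat) :
  (forall j, (N <= j)%N -> f j = 0) -> series f @ \oo --> series f N.
Proof.
move=> f0.
have : (fun=> series f N) @ \oo --> series f N by exact: cvg_cst.
apply: cvg_trans; apply: near_eq_cvg; exists N => // M /= NM; rewrite !seriesEnat /=.
rewrite [in RHS](big_cat_nat (leq0n N) NM) /= [X in _ + X]big_nat.
by rewrite [X in _ + X]big1 ?addr0 // => j /andP[Nj _]; exact: f0.
Qed.

End SeriesTails.

Section Ell2.
Local Open Scope classical_set_scope.
Local Open Scope complex_scope.
Local Open Scope ring_scope.
Variable R : realType.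
Implicit Types z : nat -> R[i].

Definition trunc z (N : nat) : nat -> R[i] := fun j => if (j < N)%N then z j else 0.

Lemma ell2_trunc z N : ell2 (trunc z N).
Proof.
rewrite /ell2 /=; apply/cvg_ex.
eexists; apply: (@series_finsupp_cvg _ R[i]^o _ N) => j Nj.
by rewrite /trunc ltnNge Nj /= normr0 expr0n.
Qed.

Lemma ell2_unit (k : nat) : ell2 (fun j => (j == k)%:R : R[i]).
Proof.
have -> : (fun j => (j == k)%:R : R[i]) = trunc (fun j => (j == k)%:R) k.+1.
  apply/funext => j; rewrite /trunc ltnS; case: ltngtP => //.
exact: ell2_trunc.
Qed.

(** The vector z minus its truncation, written as c * z + y with c = -1: this
    is literally the form in which a unitary of l^2 is assumed linear. *)
Definition tail z (N : nat) : nat -> R[i] := fun j => -1 * trunc z N j + z j.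

(** Valued in the regular module of the complex numbers, which carries the
    topology used for limits of scalar series. *)
Definition abs_sq z : nat -> R[i]^o := fun j => `|z j| ^+ 2.

Lemma abs_sq_tail z N :
  abs_sq (tail z N) = (fun j => if (j < N)%N then 0 else abs_sq z j).
Proof.
apply/funext => j; rewrite /abs_sq /tail /trunc; case: ifP => _.
  by rewrite mulN1r addNr normr0 expr0n.
by rewrite mulr0 add0r.
Qed.

Lemma ell2_tail z N : ell2 z -> ell2 (tail z N).
Proof.
move=> /cvg_ex[l zl]; apply/cvg_ex; exists (l - series (abs_sq z) N).
by have := series_tail_cvg (N := N) zl; rewrite -abs_sq_tail.
Qed.

Lemma ell2_dot_diag z (l : R[i]^o) : series (abs_sq z) @ \oo --> l ->
  ell2_dot z z = l.
Proof.
move=> zl; rewrite /ell2_dot.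
have -> : (fun j => z j * (z j)^* : R[i]^o) = abs_sq z.
  by apply/funext => j; rewrite /abs_sq normCK.
exact: (cvg_lim (@norm_hausdorff _ R[i]^o) zl).
Qed.

Lemma ell2_dot_tail z N (l : R[i]^o) : series (abs_sq z) @ \oo --> l ->
  ell2_dot (tail z N) (tail z N) = l - series (abs_sq z) N.
Proof.
move=> zl; apply: ell2_dot_diag.
by have := series_tail_cvg (N := N) zl; rewrite -abs_sq_tail.
Qed.

Section Unitary.
Variables (u : (nat -> R[i]) -> (nat -> R[i])) (uU : ell2_unitary u).

Lemma ell2_unitary0 : u (fun=> 0) = (fun=> 0).
Proof.
case: uU => _ lu _; have z0 : ell2 (fun=> 0 : R[i]).
  have -> : (fun=> 0 : R[i]) = trunc (fun=> 0) 0 by apply/funext => j.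
  exact: ell2_trunc.
have := lu (-1) _ _ z0 z0.
have -> : (fun j : nat => -1 * 0 + 0 : R[i]) = (fun=> 0).
  by apply/funext => j; rewrite mulr0 addr0.
by move=> ->; apply/funext => j; rewrite mulN1r addNr.
Qed.

(** Linearity, applied once for each of the first N basis vectors. *)
Lemma ell2_unitary_trunc z N :
  u (trunc z N) = fun j => \sum_(i < N) z i * u (fun k => (k == i)%:R) j.
Proof.
case: uU => _ lu _; elim: N => [|N IH].
  rewrite -[trunc z 0]/(fun=> 0) ell2_unitary0.
  by apply/funext => j; rewrite big_ord0.
have -> : trunc z N.+1 = (fun j => z N * (j == N)%:R + trunc z N j).
  apply/funext => j; rewrite /trunc ltnS; case: ltngtP => [_|_|->].
  - by rewrite mulr0 add0r.
  - by rewrite mulr0 add0r.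
  - by rewrite mulr1 addr0.
rewrite lu; [|exact: ell2_unit|exact: ell2_trunc].
by rewrite IH; apply/funext => j; rewrite big_ord_recr /= addrC.
Qed.

End Unitary.
End Ell2.

(** * Unitary changes of generators *)

Section UnitaryFamilies.
Local Open Scope classical_set_scope.
Local Open Scope complex_scope.
Local Open Scope ring_scope.

Variables (R : realType) (A : cstarAlgType R) (w : A -> R[i]) (sw : is_state w).

(** Parseval for finite sums: the cross terms of Y^* Y vanish, so Y^* Y is
    the scalar of the right-hand side. *)
Lemma norm_ortho_series (s : nat -> A) (c : nat -> R[i]) M : orthoisometric s ->
  `|series (fun j => c j *: s j) M| ^+ 2 = series (abs_sq c) M.
Proof.
move=> os; apply/esym; apply: (state_star_mul_cone sw).
have orth N j : (N <= j)%N -> star (series (fun j => c j *: s j) N) ** s j = 0.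
  elim: N => [|N IH] Nj; first by rewrite seriesEnat /= big_geq // star0 cmul0l.
  rewrite seriesS starD cmulDl IH ?(ltnW Nj) // starZ cmulZl os.
  by rewrite ltn_eqF // scaler0 addr0.
elim: M => [|M IH].
  by rewrite !seriesEnat /= !big_geq // star0 cmul0l scale0r.
have orth' : star (s M) ** series (fun j => c j *: s j) M = 0.
  by apply: (can_inj (@starK _ A)); rewrite starM starK orth // star0.
rewrite !seriesS starD cmulDl !cmulDr IH starZ !cmulZr !cmulZl orth // orth'.
rewrite os eqxx !scaler0 addr0 add0r scalerA -scalerDl; congr ((_ + _) *: _).
by rewrite /abs_sq normCK.
Qed.

(** Surjectivity of the unitary gives z with u z = e_k, and s_k is then the
    sum of the z_i t_i. Indeed s_k minus the N-th partial sum is the element of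
    the closed span of s with coordinates u (z - z_N), where z_N is the
    truncation of z; its norm is the l^2 norm of z - z_N, because u is
    isometric, and this tends to 0. *)
Lemma ell2_unitary_family_span (s t : nat -> A) (g : nat -> nat -> R[i])
    (u : (nat -> R[i]) -> (nat -> R[i])) :
  orthoisometric s -> ell2_unitary u ->
  (forall i j, g i j = u (fun k => (k == j)%:R) i) ->
  (forall i, series (fun j => g j i *: s j) @ \oo --> t i) ->
  range s `<=` closed_span (range t).
Proof.
move=> os uU gu ts _ [k _ <-].
have [z zE uz] : exists2 z, ell2 z & u z = (fun j => (j == k)%:R).
  case: (uU) => imu _ _; have : (u @` @ell2 R) (fun j => (j == k)%:R).
    by rewrite imu; exact: ell2_unit.
  by case=> z zE uz; exists z.
have /cvg_ex[l zl] := zE.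
pose y N := \sum_(i < N) z i *: t i.
have dist N : `|s k - y N| ^+ 2 = l - series (abs_sq z) N :> R[i]^o.
  (* The coordinates of s_k - y_N in the closed span of s. *)
  pose c := u (tail z N).
  have cE j : c j = (j == k)%:R - \sum_(i < N) z i * g j i.
    have -> : c = (fun j => -1 * u (trunc z N) j + u z j).
      by case: (uU) => _ lu _; exact: (lu (-1) _ _ (@ell2_trunc _ z N) zE).
    rewrite uz (ell2_unitary_trunc uU) mulN1r addrC; congr (_ - _).
    by apply: eq_bigr => i _; rewrite gu.
  have c_lim : series (fun j => c j *: s j) @ \oo --> s k - y N.
    have -> : series (fun j => c j *: s j) = (fun M =>
        series (fun j => (j == k)%:R *: s j) M -
        \sum_(i < N) z i *: series (fun j => g j i *: s j) M).
      apply/funext => M; rewrite !seriesEnat /=.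
      under [X in _ = _ - X]eq_bigr do rewrite scaler_sumr.
      rewrite exchange_big /= -sumrB; apply: eq_bigr => j _.
      rewrite cE scalerBl scaler_suml; congr (_ - _).
      by apply: eq_bigr => i _; rewrite scalerA.
    apply: cvgB.
      have : series (fun j => (j == k)%:R *: s j) k.+1 = s k.
        rewrite seriesEnat /= big_nat_recr //= eqxx scale1r.
        rewrite big_nat big1 ?add0r // => j /andP[_ jk].
        by rewrite ltn_eqF // scale0r.
      move=> <-; apply: series_finsupp_cvg => j kj.
      by rewrite gtn_eqF // scale0r.
    apply: cvg_big => [|i _]; first exact: add_continuous.
    by apply: cvgZl_tmp; exact: ts.
  have sq_lim : series (abs_sq c) @ \oo --> (`|s k - y N| ^+ 2 : R[i]^o).
    have -> : series (abs_sq c) =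
        (fun M => `|series (fun j => c j *: s j) M| ^+ 2 : R[i]^o).
      by apply/funext => M; rewrite norm_ortho_series.
    exact: cvg_norm_sqr c_lim.
  rewrite -(ell2_dot_diag sq_lim) -(ell2_dot_tail N zl).
  by case: (uU) => _ _ ud; apply: ud; exact: ell2_tail.
apply/closure_near => e e0.
have e2 : 0 < e ^+ 2 by rewrite exprn_gt0.
have [N] : exists N, `|l - series (abs_sq z) N| < e ^+ 2.
  by have /cvgrPdist_lt/(_ _ e2)/filter_ex := zl.
rewrite -dist ger0_norm ?exprn_ge0 // ltr_pXn2r ?nnegrE ?(ltW e0) // => yN.
exists (y N) => //; apply: subspace_sum; first exact: lin_span_subspace.
by move=> i; apply: sub_lin_span; exists i.
Qed.

(** Here t = s g, so s = t g^*, by orthonormality of the rows of g. *)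
Lemma unitarymx_family_span (m : nat) (s t : 'I_m -> A) (g : 'I_m -> 'I_m -> R[i]) :
  (\matrix_(i < m, j < m) g i j) \is unitarymx ->
  (forall i, t i = \sum_(j < m) g j i *: s j) ->
  range s `<=` closed_span (range t).
Proof.
move=> /unitarymxP gU ts _ [k _ <-]; apply: subset_closure.
have rows j : \sum_(i < m) (g k i)^* * g j i = (j == k)%:R.
  have := congr1 (fun M => fun_of_matrix M j k) gU; rewrite !mxE => <-.
  by apply: eq_bigr => i _; rewrite !mxE mulrC.
have -> : s k = \sum_(i < m) (g k i)^* *: t i.
  under eq_bigr do rewrite ts scaler_sumr.
  rewrite exchange_big /= (bigD1 k) //= [X in _ + X]big1 => [|j jk].
    rewrite addr0; under eq_bigr do rewrite scalerA.
    by rewrite -scaler_suml rows eqxx scale1r.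
  under eq_bigr do rewrite scalerA.
  by rewrite -scaler_suml rows (negbTE jk) scale0r.
exact: lin_span_sum.
Qed.

(** One inclusion is the definition of t, a limit of sums in the span of s when
    n is infinite; unitarity of g enters only in the other. *)
Lemma in_U_family_span (n : enat) (s t : idx n -> A) (g : idx n -> idx n -> R[i]) :
  orthoisometric s -> in_U g -> (forall i, has_sum (fun j => g j i *: s j) (t i)) ->
  range t `<=` closed_span (range s) /\ range s `<=` closed_span (range t).
Proof.
case: n s t g => [m|] s t g os gU ts; split.
- move=> _ [i _ <-]; rewrite (ts i : _ = \sum_(j < m) _).
  exact/subset_closure/lin_span_sum.
- exact: unitarymx_family_span gU ts.
- move=> _ [i _ <-]; apply: closure_cvg (ts i) => M /=.
  by rewrite seriesEnat; exact: lin_span_sum.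
- by case: gU => u uU gu; exact: ell2_unitary_family_span uU gu ts.
Qed.

End UnitaryFamilies.

(** * The invariant is constant on orbits *)

Theorem corollary1p3 (R : realType) (n : enat) (hn : enat_le (Some 2) n)
    (A : cstarAlgType R) (s : idx n -> A) (hs : is_cuntz_algebra s)
    (w w' : A -> R[i]%C) (hw : is_state w) (hw' : is_state w')
    (hww' : exists g : idx n -> idx n -> R[i]%C,
        in_U g /\ state_equiv w' (w \o alpha s g)) :
  kappa s w = kappa s w'.
Proof.
have [g [gU ww']] := hww'; rewrite (kappa_state_equiv s ww') /alpha.
(* In the default case alpha is the identity and both sides coincide. *)
case: xgetP => [a _ [ma ba as_sum]|//].
have os : orthoisometric s by case: hs => -[].
have [b [mb ab bb]] := star_morphism_inverse ma ba.
have [ts st] := in_U_family_span hw os gU as_sum.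
by rewrite (kappa_comp ma mb ab bb os ts st).
Qed.
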